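(* Let $n\ge 2$, let $\varepsilon\in\{1,-1\}$, and let $M$ be a finite-dimensional complex representation of the equioriented quiver $\overrightarrow{A}_n$ with rank sequence $(r^M_{i,j})_{1\le i\le j\le n}$. Then $M$ admits the structure of an $\varepsilon$-representation if and only if the following hold: \begin{enumerate} \item $r^M_{i,j}=r^M_{\sigma(j),\sigma(i)}$ for all $1\le i\le j\le n$; \item if ($n$ is odd and $\varepsilon=-1$) or ($n$ is even and $\varepsilon=+1$), then $r^M_{i,\sigma(i)}$ is even for every $i$ with $i\le\sigma(i)$. \end{enumerate}
   Context: The base field is $\mathbb{C}$. $\overrightarrow{A}_n$ is the quiver $1\to 2\to\cdots\to n$, and $\sigma(i)=n+1-i$. A representation $M$ consists of finite-dimensional vector spaces $M_1,\dots,M_n$ and linear maps $f_i:M_i\to M_{i+1}$ ($1\le i\le n-1$). For $i<j$ put $f_{i,j}=f_{j-1}\circ\cdots\circ f_i:M_i\to M_j$, and $f_{i,i}=\mathrm{Id}_{M_i}$. The rank sequence of $M$ is $r^M_{i,j}=\mathrm{rank}(f_{i,j})$, $1\le i\le j\le n$ (so $r^M_{i,i}=\dim M_i$). Let $M^0=\bigoplus_{i=1}^n M_i$. A $\sigma$-compatible $\varepsilon$-form on $M^0$ is a non-degenerate bilinear form $\langle-,-\rangle$ on $M^0$ with $\langle v,w\rangle=\varepsilon\langle w,v\rangle$ for all $v,w$, whose restriction to $M_i\times M_j$ is zero unless $j=\sigma(i)$. $M$ admits the structure of an $\varepsilon$-representation if there is a $\sigma$-compatible $\varepsilon$-form on $M^0$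 such that $\langle f_i(v),w\rangle+\langle v,f_{\sigma(i+1)}(w)\rangle=0$ for all $1\le i\le n-1$, $v\in M_i$, $w\in M_{\sigma(i+1)}$. *)

(* Defs.v *)
From HB Require Import structures.
From mathcomp Require Import all_boot all_order all_algebra.
From mathcomp Require Import reals complex.

Set Implicit Arguments.
Unset Strict Implicit.
Unset Printing Implicit Defensive.

Import GRing.Theory.
Local Open Scope ring_scope.

(* Vertices are 0-based: vertex i of the quiver 1 -> 2 -> ... -> n is the
   ordinal i - 1 : 'I_n, so that sigma(i) = n + 1 - i is rev_ord. The arrows are
   the pairs (i, j) with j = i + 1; the equality proof is irrelevant, since it
   is an equality between natural numbers. *)
Record quiver_rep (K : fieldType) (n : nat) := QuiverRep {
  rspace :> 'I_n -> vectType K;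
  rmap : forall i j : 'I_n, j = i.+1 :> nat -> 'Hom(rspace i, rspace j)
}.

Section Composites.

Variables (K : fieldType) (n : nat) (M : quiver_rep K n).

Definition hom_cast (i j : 'I_n) (e : i = j) : 'Hom(M i, M j) :=
  match e in _ = k return 'Hom(M i, M k) with erefl => \1%VF end.

Fact addn0_ord (i j : 'I_n) : j = (i + 0)%N :> nat -> i = j.
Proof. by rewrite addn0 => e; apply: val_inj. Qed.

Fact addnS_ord_lt (i j : 'I_n) k : j = (i + k.+1)%N :> nat -> (i + k < n)%N.
Proof. by rewrite addnS => e; rewrite (leq_ltn_trans _ (ltn_ord j)) // e leqnSn. Qed.

Fact addnS_ord (i j : 'I_n) k (e : j = (i + k.+1)%N :> nat) :
  j = (Ordinal (addnS_ord_lt e)).+1 :> nat.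
Proof. by rewrite e addnS. Qed.

Fixpoint rcomp_rec (i : 'I_n) (k : nat) :
    forall j : 'I_n, j = (i + k)%N :> nat -> 'Hom(M i, M j) :=
  match k with
  | 0 => fun j e => hom_cast (addn0_ord e)
  | k'.+1 => fun j e =>
      (rmap M (addnS_ord e) \o
       @rcomp_rec i k' (Ordinal (addnS_ord_lt e)) erefl)%VF
  end.

Fact le_addnB (i j : 'I_n) : (i <= j)%N -> j = (i + (j - i))%N :> nat.
Proof. by move=> le_ij; rewrite subnKC. Qed.

Definition rcomp (i j : 'I_n) (le_ij : (i <= j)%N) : 'Hom(M i, M j) :=
  rcomp_rec (le_addnB le_ij).

Lemma rcomp_recE (i j : 'I_n) k (e : j = (i + k)%N :> nat)
    (le_ij : (i <= j)%N) : rcomp le_ij = rcomp_rec e.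
Proof.
rewrite /rcomp; move: (le_addnB le_ij) => e'.
have ekk : (j - i)%N = k by rewrite e addKn.
by move: (j - i)%N e' ekk => k' e' ekk; subst k'; rewrite (eq_irrelevance e' e).
Qed.

Lemma rcomp_id (i : 'I_n) (le_ii : (i <= i)%N) : rcomp le_ii = \1%VF.
Proof.
rewrite (rcomp_recE (esym (addn0 i))) /=.
by rewrite (eq_irrelevance (addn0_ord _) erefl).
Qed.

Lemma rcompS (i j k : 'I_n) (le_ij : (i <= j)%N) (e : k = j.+1 :> nat)
    (le_ik : (i <= k)%N) :
  rcomp le_ik = (rmap M e \o rcomp le_ij)%VF.
Proof.
have eS : k = (i + (j - i).+1)%N :> nat by rewrite addnS subnKC.
rewrite (rcomp_recE eS) /= /rcomp.
have aux (j' : 'I_n) (ej : j' = j) (e1 : k = j'.+1 :> nat)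
    (e2 : j' = (i + (j - i))%N :> nat) :
    (rmap M e1 \o rcomp_rec e2 = rmap M e \o rcomp_rec (le_addnB le_ij))%VF.
  subst j'; rewrite (eq_irrelevance e1 e).
  by rewrite (eq_irrelevance e2 (le_addnB le_ij)).
by apply: aux; apply: val_inj; rewrite /= subnKC.
Qed.

Definition rank_seq (i j : 'I_n) (le_ij : (i <= j)%N) : nat :=
  \dim (limg (rcomp le_ij)).

End Composites.

Fact rev_ord_arrow n (i j : 'I_n) :
  j = i.+1 :> nat -> rev_ord i = (rev_ord j).+1 :> nat.
Proof. by move=> e /=; rewrite -e -subSn // subSS. Qed.

Fact rev_ord_le n (i j : 'I_n) : (i <= j)%N -> (rev_ord j <= rev_ord i)%N.
Proof. by move=> le_ij; rewrite leq_sub2l. Qed.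

(* The external direct sum of a finite family of vector spaces. *)
Definition dsum (K : fieldType) (n : nat) (V : 'I_n -> vectType K) :=
  {dffun forall i, V i}.

Section DirectSum.

Variables (K : fieldType) (n : nat) (V : 'I_n -> vectType K).
Implicit Types u v w : dsum V.

HB.instance Definition _ := Choice.copy (dsum V) {dffun forall i, V i}.

Definition dsum_zero : dsum V := [ffun i => 0 : V i].
Definition dsum_opp u : dsum V := [ffun i => - u i : V i].
Definition dsum_add u v : dsum V := [ffun i => u i + v i : V i].
Definition dsum_scale (a : K) u : dsum V := [ffun i => a *: u i : V i].

Fact dsum_addA : associative dsum_add.
Proof. by move=> u v w; apply/ffunP=> i; rewrite !ffunE addrA. Qed.
Fact dsum_addC : commutative dsum_add.
Proof. by move=> u v; apply/ffunP=> i; rewrite !ffunE addrC. Qed.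
Fact dsum_add0 : left_id dsum_zero dsum_add.
Proof. by move=> u; apply/ffunP=> i; rewrite !ffunE add0r. Qed.
Fact dsum_addN : left_inverse dsum_zero dsum_opp dsum_add.
Proof. by move=> u; apply/ffunP=> i; rewrite !ffunE addNr. Qed.

HB.instance Definition _ := GRing.isZmodule.Build (dsum V)
  dsum_addA dsum_addC dsum_add0 dsum_addN.

Fact dsum_scaleA a b u : dsum_scale a (dsum_scale b u) = dsum_scale (a * b) u.
Proof. by apply/ffunP=> i; rewrite !ffunE scalerA. Qed.
Fact dsum_scale1 : left_id 1 dsum_scale.
Proof. by move=> u; apply/ffunP=> i; rewrite !ffunE scale1r. Qed.
Fact dsum_scaleDr : right_distributive dsum_scale +%R.
Proof. by move=> a u v; apply/ffunP=> i; rewrite !ffunE scalerDr. Qed.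
Fact dsum_scaleDl u : {morph dsum_scale^~ u : a b / a + b}.
Proof. by move=> a b; apply/ffunP=> i; rewrite !ffunE scalerDl. Qed.

HB.instance Definition _ := GRing.Zmodule_isLmodule.Build K (dsum V)
  dsum_scaleA dsum_scale1 dsum_scaleDr dsum_scaleDl.

Definition dsum_inj (i : 'I_n) (x : V i) : dsum V :=
  [ffun j => dfwith (fun k => 0 : V k) x j].

End DirectSum.

Section EpsRepresentations.

Variables (K : fieldType) (n : nat) (eps : K).

(* One-sided non-degeneracy is enough: the form is (skew-)symmetric. *)
Record sigma_compatible_form (V : 'I_n -> vectType K)
    (B : {biscalar dsum V}) : Prop := SigmaCompatibleForm {
  scf_nondegenerate : forall v, (forall w, B v w = 0) -> v = 0;
  scf_sym : forall v w, B v w = eps * B w v;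
  scf_compat : forall (i j : 'I_n) (x : V i) (y : V j),
    j <> rev_ord i -> B (dsum_inj x) (dsum_inj y) = 0
}.

(* For the arrow i -> j, the vertices sigma(j) -> sigma(i) also form an arrow,
   whose map is f_{sigma(i+1)}. *)
Definition admits_eps_structure (M : quiver_rep K n) : Prop :=
  exists B : {biscalar dsum M},
    sigma_compatible_form B /\
    forall (i j : 'I_n) (e : j = i.+1 :> nat) (v : M i) (w : M (rev_ord j)),
      B (dsum_inj (rmap M e v)) (dsum_inj w)
      + B (dsum_inj v) (dsum_inj (rmap M (rev_ord_arrow e) w)) = 0.

End EpsRepresentations.

(* Main.v *)
From HB Require Import structures.
Require Import Defs.
From mathcomp Require Import all_boot all_order all_algebra.
From mathcomp Require Import reals complex zify ring.

Set Implicit Arguments.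
Unset Strict Implicit.
Unset Printing Implicit Defensive.

Import GRing.Theory.
Local Open Scope ring_scope.
Local Open Scope complex_scope.
Import VectorInternalTheory.

(* If [M] carries an eps-form, the pairings M_i x M_(sigma i) are perfect and make
   f_(i,j) adjoint, up to sign, to f_(sigma j, sigma i), so both have the same
   rank; for j = sigma i the form <f_(i,j) v, w> on M_i is antisymmetric in the
   cases of (2), so its rank is even.

   Conversely, M is a direct sum of interval representations: take the smallest
   vertex a with M_a nonzero, then the largest b with f_(a,b) nonzero, some x in
   M_a with f_(a,b) x nonzero and a functional xi with xi (f_(a,b) x) = 1; the
   chain of the f_(a,i) x splits off, the complement being the kernel of
   xi o f_(i,b) at each vertex i <= b. The rank of f_(i,j) counts the intervals
   containing [i, j], so by inclusion-exclusion (1) says that [a, b] and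
   [sigma b, sigma a] have the same multiplicity, and (2) that the multiplicity
   of each self-opposite interval is even. Hence there is an involution of the
   set of summands that reverses the intervals, without fixed points in the
   cases of (2), and pairing each basis vector with its mirror image in the
   opposite summand, with alternating signs along the chains, defines the form. *)

(** * Composites along the quiver as a total function of the two vertices *)

Section TotalComposites.

Variables (K : fieldType) (n : nat) (M : quiver_rep K n).

(* [rcomp], extended by [0] to the pairs with [j < i]. *)
Definition rcomp0 (i j : 'I_n) : 'Hom(M i, M j) :=
  if @idP (i <= j)%N is ReflectT le_ij then rcomp M le_ij else 0.

Lemma rcomp0E (i j : 'I_n) (le_ij : (i <= j)%N) : rcomp0 i j = rcomp M le_ij.
Proof.
rewrite /rcomp0; case: {-}_ / idP => [le_ij'|/(_ le_ij)//].
by rewrite (bool_irrelevance le_ij' le_ij).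
Qed.

Lemma rcomp0_gt (i j : 'I_n) : (j < i)%N -> rcomp0 i j = 0.
Proof. by rewrite /rcomp0; case: {-}_ / idP => // le_ij; rewrite ltnNge le_ij. Qed.

Lemma rcomp0_id (i : 'I_n) : rcomp0 i i = \1%VF.
Proof. by rewrite (rcomp0E (leqnn i)) rcomp_id. Qed.

Lemma rmap_rcomp0 (i j k : 'I_n) (e : k = j.+1 :> nat) v :
  (i <= j)%N -> rmap M e (rcomp0 i j v) = rcomp0 i k v.
Proof.
move=> le_ij; have le_ik : (i <= k)%N by rewrite e leqW.
by rewrite (rcomp0E le_ij) (rcomp0E le_ik) (rcompS M le_ij e) comp_lfunE.
Qed.

(** [rcomp] is built by appending arrows at the target, so prepending one at the source takes an
    induction on [k]. *)
Lemma rcomp0_rmap (i j k : 'I_n) (e : j = i.+1 :> nat) v :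
  (j <= k)%N -> rcomp0 j k (rmap M e v) = rcomp0 i k v.
Proof.
case: k => k; elim: k => [|k IHk] lt_k /=; first by rewrite e.
rewrite leq_eqVlt => /predU1P[eq_jk|lt_jk].
  have -> : Ordinal lt_k = j by apply: val_inj.
  by rewrite rcomp0_id id_lfunE -(@rmap_rcomp0 i i j e) // rcomp0_id id_lfunE.
have lt_k' : (k < n)%N by apply: ltnW.
have le_jk : (j <= Ordinal lt_k')%N by [].
have le_ik : (i <= Ordinal lt_k')%N by rewrite ltnW // -e.
by rewrite -!(@rmap_rcomp0 _ (Ordinal lt_k') (Ordinal lt_k) erefl) // IHk.
Qed.

Lemma rcomp0_comp (i j k : 'I_n) v :
  (i <= j)%N -> (j <= k)%N -> rcomp0 j k (rcomp0 i j v) = rcomp0 i k v.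
Proof.
move=> le_ij; case: k => k; elim: k => [|k IHk] lt_k /=;
  rewrite leq_eqVlt => /predU1P[eq_jk|//].
- have -> : Ordinal lt_k = j by apply: val_inj.
  by rewrite rcomp0_id id_lfunE.
- have -> : Ordinal lt_k = j by apply: val_inj.
  by rewrite rcomp0_id id_lfunE.
move=> lt_jk; have lt_k' : (k < n)%N by apply: ltnW.
rewrite -!(@rmap_rcomp0 _ (Ordinal lt_k') (Ordinal lt_k) erefl) ?IHk //.
exact: leq_trans le_ij _.
Qed.

End TotalComposites.

Lemma exists_dual_functional (K : fieldType) (V : vectType K) (y : V) :
  y != 0 -> exists phi : 'Hom(V, K^o), phi y = 1.
Proof.
move=> nz_y; have /rV0Pn[k nz_k]: v2r y != 0 by rewrite (can2_eq v2rK r2vK) linear0.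
pose F (v : V) : K^o := (v2r y 0 k)^-1 * v2r v 0 k.
have F_lin : linear F by move=> c u v; rewrite /F linearP !mxE mulrDr mulrCA.
pose FL := GRing.isLinear.Build _ _ _ _ F F_lin.
pose Fl : {linear V -> K^o} := HB.pack F FL.
by exists (linfun Fl); rewrite lfunE /= /F mulVf.
Qed.

(** * Splitting into interval representations *)

Section IntervalDecomposition.

Variables (K : fieldType) (n : nat) (M : quiver_rep K n).

(* The summand of index [t] is supported on the interval [a t, b t] of vertices,
   where it has the basis vectors [x t i] with dual coordinates [xi t i]. *)
Record interval_decomposition (U : forall i, {vspace M i}) (T : finType)
    (a b : T -> 'I_n) (x : T -> forall i, M i)
    (xi : T -> forall i, 'Hom(M i, K^o)) : Prop := IntervalDecomposition {
  idec_le : forall t, (a t <= b t)%N;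
  idec_mem : forall t i, x t i \in U i;
  idec_map : forall t (i j : 'I_n) (e : j = i.+1 :> nat),
    rmap M e (x t i) = if (a t <= i)%N then x t j else 0;
  idec_span : forall i v, v \in U i -> v = \sum_t xi t i v *: x t i;
  idec_dual : forall s t i,
    xi t i (x s i) = ((s == t) && (a t <= i <= b t)%N)%:R
}.

(** Induction on the total dimension of [U]. Working with a stable family of subspaces of a fixed
    [M] lets the complement of a split-off chain be again such a family. *)
Lemma exists_interval_decomposition (U : forall i, {vspace M i}) :
  (forall (i j : 'I_n) (e : j = i.+1 :> nat) v, v \in U i -> rmap M e v \in U j) ->
  exists (T : finType) a b x xi, @interval_decomposition U T a b x xi.
Proof.
have [d] := ubnP (\sum_i \dim (U i))%N; elim: d U => // d IHd U lt_d stabU.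
have [U0|] := boolP [forall i, U i == 0%VS].
  exists void, (of_void _), (of_void _), (of_void _), (of_void _).
  split=> [[]|[]|[]|i v|s []//]; rewrite (eqP (forallP U0 i)) memv0 => /eqP->.
  by rewrite big1 // => -[].
rewrite negb_forall => /existsP[a0 nz_a0].
case: (@arg_minnP _ a0 (fun i => U i != 0%VS) (@nat_of_ord n) nz_a0).
move=> a nz_a min_a.
have Ulow (i : 'I_n) : (i < a)%N -> U i = 0%VS.
  by apply: contraTeq => /min_a; rewrite leqNgt.
pose P (b : 'I_n) := [&& (a <= b)%N & (rcomp0 M a b @: U a != 0)%VS].
have Pa : P a by rewrite /P leqnn rcomp0_id lim1g.
case: (@arg_maxnP _ a P (@nat_of_ord n) Pa) => b /andP[le_ab nz_b] max_b.
have [x0 x0U nz_y] : exists2 x0, x0 \in U a & rcomp0 M a b x0 != 0.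
  have: vpick (rcomp0 M a b @: U a)%VS \in (rcomp0 M a b @: U a)%VS by apply: memv_pick.
  by case/memv_imgP=> x0 x0U def_x0; exists x0; rewrite // -def_x0 vpick0.
have [phi phi1] := exists_dual_functional nz_y.
pose x i := rcomp0 M a i x0.
pose zeta i : 'Hom(M i, K^o) := (phi \o rcomp0 M i b)%VF.
have xU i : x i \in U i.
  rewrite /x; have [lt_ia|] := ltnP i a; first by rewrite rcomp0_gt // lfunE mem0v.
  case: i => i; elim: i => [|i IHi] lt_i le_ai.
    have ->: Ordinal lt_i = a by apply/val_inj/esym/eqP; rewrite -leqn0.
    by rewrite rcomp0_id id_lfunE.
  move: le_ai; rewrite /= leq_eqVlt => /predU1P[eq_ai|lt_ai].
    have ->: Ordinal lt_i = a by apply: val_inj.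
    by rewrite rcomp0_id id_lfunE.
  have lt_i' : (i < n)%N by apply: ltnW.
  by rewrite -(@rmap_rcomp0 _ _ _ _ (Ordinal lt_i') (Ordinal lt_i) erefl) // stabU ?IHi.
have x_hi (i : 'I_n) : (b < i)%N -> x i = 0.
  move=> lt_bi; have le_ai := leq_trans le_ab (ltnW lt_bi).
  apply/eqP; apply: contraTT lt_bi => nz_x; rewrite -leqNgt.
  apply: max_b; rewrite /P le_ai /=; apply: contra nz_x => /eqP im0.
  by rewrite -memv0 -im0 memv_img.
have zeta_hi (i : 'I_n) v : (b < i)%N -> zeta i v = 0.
  by move=> lt_bi; rewrite comp_lfunE rcomp0_gt // lfunE linear0.
have x_lo (i : 'I_n) : (i < a)%N -> x i = 0 by move=> lt_ia; rewrite /x rcomp0_gt // lfunE.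
have zetax (i : 'I_n) : zeta i (x i) = (a <= i <= b)%N%:R.
  have [le_ai|/x_lo->] := leqP a i; last by rewrite linear0.
  have [le_ib|/zeta_hi//] := leqP i b.
  by rewrite comp_lfunE rcomp0_comp.
have zeta_map (i j : 'I_n) (e : j = i.+1 :> nat) v : (j <= b)%N ->
    zeta j (rmap M e v) = zeta i v.
  by move=> le_jb; rewrite !comp_lfunE rcomp0_rmap.
pose N i := (U i :&: lker (zeta i))%VS.
have memN i v : (v \in N i) = (v \in U i) && (zeta i v == 0).
  by rewrite memv_cap memv_ker.
have [||T [a' [b' [x' [xi' [le' mem' map' span' dual']]]]]] := IHd N.
(* The dimension drops strictly at [a], where [x a] lies in [U a] but not in [N a]. *)
- rewrite -ltnS (leq_trans _ lt_d) // ltnS.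
  rewrite (bigD1 a) //= [X in (_ < X)%N](bigD1 a) //= -addSn leq_add //; last first.
    by apply: leq_sum => i _; rewrite dimvS ?capvSl.
  rewrite ltn_neqAle dimvS ?capvSl // andbT.
  apply/negP=> /eqP eq_dim; have /eqP eqN : N a == U a.
    by rewrite eqEdim capvSl eq_dim leqnn.
  by have:= xU a; rewrite -eqN memN zetax leqnn le_ab /= oner_eq0 andbF.
- move=> i j e v; rewrite !memN => /andP[vU zv]; rewrite stabU //=.
  have [/zeta_map->//|/zeta_hi->] := leqP j b; exact: eqxx.
pose proj i v := v - zeta i v *: x i.
have projN i v : v \in U i -> proj i v \in N i.
  move=> vU; rewrite memN /proj rpredB ?rpredZ ?xU //= linearB linearZ /= zetax.
  (* Below [a] the vector [x i] is zero and corrects nothing; there [U i = 0] by minimality of [a].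
     Above [b] the functional [zeta i] is zero. *)
  have [le_ai|/Ulow U0] := leqP a i; last first.
    by move: vU; rewrite U0 memv0 => /eqP->; rewrite linear0 scale0r subr0.
  have [le_ib|/zeta_hi->] := leqP i b; last by rewrite scale0r subr0.
  by rewrite [_ *: _]mulr1 subrr.
(* The induction hypothesis controls [xi'] only on [N]; composing it with the projection [proj]
   makes it kill the chain [x]. *)
pose xi t i : 'Hom(M i, K^o) := xi' t i - (xi' t i (x i)) *: zeta i.
have xiE t i v : xi t i v = xi' t i (proj i v).
  rewrite add_lfunE opp_lfunE scale_lfunE /proj linearB; congr (_ - _).
  by rewrite linearZ; apply: mulrC.
exists (option T : finType), (fun t => if t is Some t' then a' t' else a).
exists (fun t => if t is Some t' then b' t' else b).
exists (fun t => if t is Some t' then x' t' else x).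
exists (fun t => if t is Some t' then xi t' else zeta).
have x'U t i : x' t i \in U i by have:= mem' t i; rewrite memN => /andP[].
have zetax' t i : zeta i (x' t i) = 0.
  by have:= mem' t i; rewrite memN => /andP[_ /eqP].
have xix t i : xi t i (x i) = 0.
  rewrite xiE /proj zetax.
  have [le_ai|/x_lo->] := leqP a i; last by rewrite scaler0 subrr linear0.
  have [le_ib|/x_hi->] := leqP i b; last by rewrite scaler0 subrr linear0.
  by rewrite scale1r subrr linear0.
have xix' s t i : xi t i (x' s i) = xi' t i (x' s i).
  by rewrite xiE /proj zetax' scale0r subr0.
split=> [[t|]|[t|]|[t|]|i v vU|[s|] [t|]] //=.
- by move=> i j e; rewrite map'.
- move=> i j e; rewrite leqNgt; case: ltnP => [lt_ia|le_ai] /=.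
    by rewrite x_lo // linear0.
  by rewrite rmap_rcomp0.
- rewrite (bigD1 None) //= (reindex_omap Some id) => [|[t|]] //=.
  under eq_bigl => t do rewrite eqxx.
  under eq_bigr => t do rewrite xiE.
  by rewrite -span' ?projN // /proj addrC subrK.
- by move=> i; rewrite xix' dual'.
Qed.

End IntervalDecomposition.

(** A family with dual functionals is free: [phi t] applied to a vanishing combination isolates the
    coefficient of [y t]. *)
Lemma dim_span_dual (K : fieldType) (V : vectType K) (T : finType) (P : pred T)
    (y : T -> V) (phi : T -> 'Hom(V, K^o)) :
    {in P &, forall s t, phi t (y s) = (s == t)%:R} ->
  \dim <<[seq y t | t in P]>> = #|P|.
Proof.
move=> dual; have /eqP-> : free [seq y t | t in P]; last by rewrite size_map -cardE.
set X := image _ _; have sizeX : size X = #|P| by rewrite size_map -cardE.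
apply/(@freeP _ _ _ (in_tuple X)) => k sum0 i.
have Xi (j : 'I_(size X)) : exists2 t, t \in P & X`_j = y t /\ index t (enum P) = j.
  have lt_j : (j < size (enum P))%N by rewrite -cardE -sizeX.
  have [t0 _] : exists t0, t0 \in enum P.
    by case: (enum P) lt_j => // t0 ? _; exists t0; rewrite inE eqxx.
  exists (nth t0 (enum P) j); first by rewrite -mem_enum mem_nth.
  by rewrite index_uniq ?enum_uniq // (nth_map t0).
have [t Pt [Xt def_i]] := Xi i.
have := congr1 (phi t) sum0; rewrite linear_sum linear0 (bigD1 i) //= big1 => [|j ne_ji].
  by rewrite linearZ Xt /= dual // eqxx addr0 => /(etrans (esym (mulr1 _))).
have [t' Pt' [-> def_j]] := Xi j; rewrite linearZ /= dual //.
case: eqP => [eq_t|_]; last exact: scaler0.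
by case/eqP: ne_ji; apply: val_inj; rewrite /= -def_j eq_t.
Qed.

(** * Coordinates and ranks in an interval decomposition *)

Section Coordinates.

Variables (K : fieldType) (n : nat) (M : quiver_rep K n) (T : finType).
Variables (a b : T -> 'I_n) (x : T -> forall i, M i) (xi : T -> forall i, 'Hom(M i, K^o)).
Hypothesis decM : interval_decomposition (fun=> fullv) a b x xi.

Let dual := idec_dual decM.
Let span i v := idec_span decM (memvf v : v \in (fullv : {vspace M i})).

(** By [idec_dual] every coordinate of [x t i] off its interval is zero, hence so is the vector by
    [idec_span]. *)
Lemma idec_out t (i : 'I_n) : ~~ (a t <= i <= b t)%N -> x t i = 0.
Proof.
move=> out; rewrite (span (x t i)) big1 // => s _; rewrite dual.
by case: eqP => [<-|_]; rewrite ?(negPf out) scale0r.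
Qed.

Lemma rcomp0_idec t (i j : 'I_n) : (i <= j)%N ->
  rcomp0 M i j (x t i) = if (a t <= i)%N then x t j else 0.
Proof.
case: (leqP (a t) i) => [le_ai|lt_ia]; last first.
  by rewrite idec_out ?linear0 // negb_and -ltnNge lt_ia.
case: j => j; elim: j => [|j IHj] lt_j le_ij.
  have -> : Ordinal lt_j = i by apply/val_inj/esym/eqP; rewrite -leqn0.
  by rewrite rcomp0_id id_lfunE.
move: le_ij; rewrite /= leq_eqVlt => /predU1P[eq_ij|lt_ij].
  have -> : Ordinal lt_j = i by apply: val_inj.
  by rewrite rcomp0_id id_lfunE.
have lt_j' : (j < n)%N by apply: ltnW.
rewrite -(@rmap_rcomp0 _ _ _ _ (Ordinal lt_j') (Ordinal lt_j) erefl) // IHj //.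
by rewrite (idec_map decM) (leq_trans le_ai).
Qed.

Lemma idec_coord_rmap t (i j : 'I_n) (e : j = i.+1 :> nat) v :
  xi t j (rmap M e v) = ((a t <= i)%N && (j <= b t)%N)%:R * xi t i v.
Proof.
rewrite {1}(span v) !linear_sum (bigD1 t) //= big1 => [|s ne_st].
  rewrite !linearZ /= (idec_map decM) addr0 [LHS]mulrC; congr (_ * _).
  case: ifP => le_ai; last exact: linear0.
  by rewrite dual eqxx e (leqW le_ai).
rewrite !linearZ /= (idec_map decM); case: ifP => _; last by rewrite linear0 scaler0.
by rewrite dual (negPf ne_st) scaler0.
Qed.

(** The composite sends [x t i] to [x t j] when the interval of [t] contains both vertices and kills
    the other basis vectors; the surviving images are independent, having the dual functionals
    [xi t j]. *)
Lemma rank_idec (i j : 'I_n) (le_ij : (i <= j)%N) :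
  rank_seq M le_ij = #|[pred t | (a t <= i)%N && (j <= b t)%N]|.
Proof.
rewrite -(@dim_span_dual _ (M j) _ _ (x^~ j) (xi^~ j)) => [|s t].
  rewrite /rank_seq -rcomp0E; congr (\dim _); apply/eqP; rewrite eqEsubv.
  apply/andP; split.
    apply/subvP=> _ /memv_imgP[v _ ->]; rewrite (span v) linear_sum memv_suml // => t _.
    rewrite linearZ memvZ // [X in X \in _]rcomp0_idec //.
    case: ifP => [le_ai|_]; last exact: mem0v.
    have [le_jb|lt_bj] := leqP j (b t); last first.
      by rewrite idec_out ?mem0v // negb_and -!ltnNge lt_bj orbT.
    by apply/memv_span/image_f; rewrite inE le_ai.
  apply/span_subvP=> _ /imageP[t /andP[le_ai _] ->].
  by rewrite -[x t j](_ : rcomp0 M i j (x t i) = _) ?memv_img ?memvf ?rcomp0_idec ?le_ai.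
rewrite !inE => _ /andP[le_ai le_jb].
by rewrite dual le_jb (leq_trans le_ai le_ij) !andbT.
Qed.

End Coordinates.

(* Matching the [k]-th element of a fibre with the [k]-th element of the opposite
   one, and consecutive elements within a self-opposite fibre. *)
Lemma fibre_involution (T X : finType) (h : T -> X) (s : X -> X) (alt : bool) :
    involutive s ->
    (forall z, #|[pred t | h t == z]| = #|[pred t | h t == s z]|) ->
    (alt -> forall z, s z = z -> ~~ odd #|[pred t | h t == z]|) ->
  exists (tau : T -> T) (c : T -> bool), [/\ involutive tau,
    forall t, h (tau t) = s (h t) & forall t, c (tau t) = alt (+) c t].
Proof.
move=> sK eq_card even_card; pose e z := enum [pred t | h t == z].
pose k t := index t (e (h t)).
(* Exchanges [2m] and [2m + 1]. *)
pose swap k := if odd k then k.-1 else k.+1.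
have swapK : involutive swap.
  move=> m; rewrite /swap; case odd_m: (odd m); last by rewrite /= odd_m.
  by case: m odd_m => //= m /negPf->.
pose pi z k := if alt && (s z == z) then swap k else k.
pose tau t := nth t (e (s (h t))) (pi (h t) (k t)).
have mem_e t z : (t \in e z) = (h t == z) by rewrite mem_enum.
have lt_pi t : (pi (h t) (k t) < size (e (s (h t))))%N.
  have lt_k : (k t < size (e (s (h t))))%N.
    by rewrite -cardE -eq_card cardE index_mem mem_e.
  rewrite /pi; case: ifP => // /andP[alt1 /eqP sht].
  (* Since the fibre has even size, the partner [k.+1] of an even position is still in range. *)
  have := even_card alt1 _ sht; rewrite cardE -/(e _) -{1}sht.
  by rewrite /swap; case: ifP; lia.
have h_tau t : h (tau t) = s (h t) by apply/eqP; rewrite -mem_e mem_nth.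
have k_tau t : k (tau t) = pi (h t) (k t).
  by rewrite /k h_tau index_uniq ?enum_uniq.
have tauK : involutive tau.
  move=> t; rewrite {1}/tau h_tau k_tau sK (set_nth_default t); last first.
    by have:= lt_pi (tau t); rewrite h_tau k_tau sK.
  have -> : pi (s (h t)) (pi (h t) (k t)) = k t.
    by rewrite /pi sK eq_sym; case: (alt && _) => //; rewrite swapK.
  by rewrite nth_index ?mem_e.
(* When [alt] holds, [c] has to separate [t] from [tau t]: by parity of the position inside a
   self-opposite fibre, and by the enumeration order of [X] between two distinct opposite fibres. *)
exists tau, (fun t => alt && (if s (h t) == h t then odd (k t)
  else (enum_rank (h t) < enum_rank (s (h t)))%N)).
split=> // t; rewrite h_tau k_tau sK /pi eq_sym; case: (alt) => //=.
case: eqP => [_|/eqP ne_s] /=.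
  by rewrite /swap; case: (k t) => //= m; case: ifP => //=; case: odd.
by case: ltngtP => // /val_inj/enum_rank_inj/eqP; rewrite (negPf ne_s).
Qed.

(** * Multiplicities of intervals from counts of containing intervals *)

Section IntervalMultiplicities.

Variables (n : nat) (T : finType) (a b : T -> 'I_n).
Hypothesis le_ab : forall t, (a t <= b t)%N.

(** The strict inequality shifts [i] by one, so that the boundary values [c 0 j = 0] and [c i n = 0]
    cover the ends of the quiver. *)
Let c (i j : nat) := #|[pred t | (a t < i)%N && (j <= b t)%N]|.

(** Inclusion-exclusion, checked for each [t] separately and written without subtraction. *)
Lemma interval_mult (p q : 'I_n) :
  (#|[pred t | (a t, b t) == (p, q)]| + (c p q + c p.+1 q.+1) = c p.+1 q + c p q.+1)%N.
Proof.
rewrite /c -!sum1_card !(big_mkcond (fun t => t \in _)) -!big_split /=.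
apply: eq_bigr => t _; rewrite !inE xpair_eqE -!val_eqE /=.
by do !case: ifP; lia.
Qed.

Hypothesis symc : forall i j : 'I_n, (i <= j)%N ->
  #|[pred t | (a t <= i)%N && (j <= b t)%N]|
    = #|[pred t | (a t <= rev_ord j)%N && (rev_ord i <= b t)%N]|.

(** This is [symc] at [(i.-1, j)], extended to [i = 0] and [j = n], where both sides are zero. *)
Lemma interval_count_sym i j : (i <= j.+1)%N -> (j <= n)%N ->
  c i j = c (n - j) (n - i).
Proof.
case: i => [|i] le_ij le_jn.
  rewrite subn0 /c [RHS]eq_card0 ?eq_card0 // => t; rewrite !inE //.
  by rewrite [(n <= _)%N]leqNgt ltn_ord andbF.
move: le_jn; rewrite leq_eqVlt => /predU1P[->|lt_jn].
  rewrite subnn /c [RHS]eq_card0 ?eq_card0 // => t; rewrite !inE //.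
  by rewrite [(n <= _)%N]leqNgt ltn_ord andbF.
have lt_in : (i < n)%N by apply: leq_ltn_trans lt_jn.
have := symc (i := Ordinal lt_in) (j := Ordinal lt_jn) le_ij.
rewrite /c => /= e; rewrite [LHS]e; apply: eq_card => t; rewrite !inE.
by rewrite -[(n - j)%N]subnSK.
Qed.

Lemma interval_involution (alt : bool) :
    (alt -> forall i : 'I_n, (i <= rev_ord i)%N ->
       ~~ odd #|[pred t | (a t <= i)%N && (rev_ord i <= b t)%N]|) ->
  exists (tau : T -> T) (sg : T -> bool), [/\ involutive tau,
    forall t, a (tau t) = rev_ord (b t), forall t, b (tau t) = rev_ord (a t)
    & forall t, sg (tau t) = alt (+) sg t].
Proof.
move=> even_c; pose h t := (a t, b t).
pose s (z : 'I_n * 'I_n) := (rev_ord z.2, rev_ord z.1).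
have mult0 (p q : 'I_n) : (q < p)%N -> #|[pred t | h t == (p, q)]| = 0%N.
  move=> lt_qp; apply: eq_card0 => t; rewrite !inE; apply/negP => /eqP[ap bq].
  by have := le_ab t; rewrite ap bq leqNgt lt_qp.
have sK : involutive s by case=> p q; rewrite /s /= !rev_ordK.
have [||tau [sg [tauK h_tau sg_tau]]] := @fibre_involution T _ h s alt sK.
- case=> p q; rewrite [s _]/s /=; have [le_pq|lt_qp] := leqP p q; last first.
    by rewrite !mult0 //=; move: (ltn_ord p) lt_qp; lia.
  have := interval_mult p q; have := interval_mult (rev_ord q) (rev_ord p).
  have lt_pn := ltn_ord p; have lt_qn := ltn_ord q.
  rewrite /= !subnSK // (interval_count_sym (i := p) (j := q)) //; try lia.
  rewrite (interval_count_sym (i := p.+1) (j := q)) //; try lia.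
  rewrite (interval_count_sym (i := p) (j := q.+1)) //; try lia.
  rewrite (interval_count_sym (i := p.+1) (j := q.+1)) //; try lia.
  rewrite /h; set N1 := #|_|; set N2 := #|_|. lia.
- move=> /even_c{}even_c [p q]; rewrite /s => -[_ <-] /=.
  have := interval_mult p (rev_ord p); rewrite /h /=; set N := #|_|.
  have [le_p|lt_p] := leqP p (rev_ord p); last by move=> _; rewrite /N mult0.
  have lt_pn := ltn_ord p; have lt_rn := ltn_ord (rev_ord p); rewrite /= in lt_rn le_p.
  have even1 : ~~ odd (c p.+1 (n - p.+1)) by have := even_c p le_p.
  have even2 : ~~ odd (c p (n - p)).
    case def_p: (p : nat) => [|p'].
      by rewrite subn0 /c eq_card0 // => t; rewrite !inE.
    have lt_p'n : (p' < n)%N by move: lt_pn; rewrite def_p; apply: ltnW.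
    by have := even_c (Ordinal lt_p'n); rewrite /=; apply; lia.
  (* Reversal exchanges the two counts added to [N], so their sum is even; the two counts on the
     other side are even by [even1] and [even2]. *)
  rewrite (interval_count_sym (i := p.+1) (j := (n - p.+1).+1)) ?subKn //; try lia.
  rewrite subnSK // subKn; last exact: ltnW.
  move: (c _ _) (c _ _) (c _ _) even1 even2 => *; lia.
exists tau, sg; split=> // t; by case: (h_tau t).
Qed.

End IntervalMultiplicities.

(* Writing [A = L R] with [L], [R] of full rank gives [A = R^T S R] with [S]
   invertible and antisymmetric, so that [det S = (-1)^r det S]. *)
Lemma antisym_rank_even (K : fieldType) (m : nat) (A : 'M[K]_m) :
  2%:R != 0 :> K -> A^T = - A -> ~~ odd (\rank A).
Proof.
move=> nz2 skewA.
have [r [L [R [def_r defA freeR]]]] : exists r (L : 'M_(m, r)) (R : 'M_(r, m)),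
    [/\ \rank A = r, A = L *m R & row_free R].
  by exists (\rank A), (col_base A), (row_base A); rewrite mulmx_base row_base_free.
have [R' RR'] := row_freeP freeR.
(* Multiplying [A = - R^T L^T] on the right by [R'] gives [L = R^T S] for this [S]. *)
pose S := - (L^T *m R').
have defL : L = R^T *m S.
  by rewrite /S mulmxN (mulmxA R^T) -trmx_mul -defA skewA mulNmx opprK defA -mulmxA RR' mulmx1.
have defA' : A = R^T *m S *m R by rewrite -defL.
have inner Z : R'^T *m (R^T *m Z *m R) *m R' = Z.
  by rewrite -!mulmxA RR' mulmx1 mulmxA -trmx_mul RR' trmx1 mul1mx.
have skewS : S^T = - S.
  rewrite -[S^T]inner -[in RHS](inner S) -defA' -mulNmx -mulmxN -skewA defA'.
  by rewrite !trmx_mul trmxK !mulmxA.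
have unitS : S \in unitmx.
  rewrite -row_free_unit -row_leq_rank -{1}def_r defA'.
  exact: leq_trans (mxrankM_maxl _ _) (mxrankM_maxr _ _).
rewrite def_r; apply/negP=> odd_r; move: unitS; rewrite unitmxE unitfE.
have := det_tr S; rewrite skewS -scaleN1r detZ -signr_odd odd_r expr1 mulN1r.
move/eqP; rewrite eq_sym -addr_eq0 -mulr2n -mulr_natl mulf_eq0 (negPf nz2) /=.
by move=> ->.
Qed.

(** * Gram matrices of pairings and ranks of adjoint maps *)

Section GramMatrices.

Variable K : fieldType.

Lemma rank_limg (U V : vectType K) (f : 'Hom(U, V)) : \dim (limg f) = \rank (f2mx f).
Proof.
by rewrite unlock /dimv genmxE eqmxMfull // -sub1mx genmxE submx1.
Qed.

Lemma exists_gram (V W : vectType K) (beta : V -> W -> K) :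
    bilinear_for *%R *%R beta ->
  exists G : 'M_(dim V, dim W),
    forall v w, beta v w = (v2r v *m G *m (v2r w)^T) 0 0.
Proof.
move=> [linl linr].
have sl w I r (P : pred I) (F : I -> V) c :
    beta (\sum_(i <- r | P i) c i *: F i) w = \sum_(i <- r | P i) c i * beta (F i) w.
  pose bL := GRing.isLinear.Build K V K *%R (beta^~ w) (linl w).
  pose bl : {linear V -> K | *%R} := HB.pack (beta^~ w) bL.
  rewrite -[LHS]/(bl _) linear_sum; apply: eq_bigr => i _; exact: linearZ.
have sr v I r (P : pred I) (F : I -> W) c :
    beta v (\sum_(i <- r | P i) c i *: F i) = \sum_(i <- r | P i) c i * beta v (F i).
  pose bL := GRing.isLinear.Build K W K *%R (beta v) (linr v).
  pose br : {linear W -> K | *%R} := HB.pack (beta v) bL.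
  rewrite -[LHS]/(br _) linear_sum; apply: eq_bigr => i _; exact: linearZ.
have expand (X : vectType K) (v : X) : v = \sum_i v2r v 0 i *: r2v (delta_mx 0 i).
  rewrite -[v in LHS]v2rK {1}(row_sum_delta (v2r v)) linear_sum.
  by apply: eq_bigr => i _; rewrite linearZ.
exists (\matrix_(i, j) beta (r2v (delta_mx 0 i)) (r2v (delta_mx 0 j))) => v w.
rewrite {1}(expand _ v) {1}(expand _ w) sl !mxE.
under [RHS]eq_bigr => j _ do rewrite !mxE big_distrl /=.
rewrite exchange_big /=; apply: eq_bigr => i _; rewrite sr big_distrr /=.
by apply: eq_bigr => j _; rewrite !mxE mulrAC mulrA.
Qed.

Lemma gram_row_free (V W : vectType K) (beta : V -> W -> K) (G : 'M_(dim V, dim W)) :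
    (forall v w, beta v w = (v2r v *m G *m (v2r w)^T) 0 0) ->
    (forall v, (forall w, beta v w = 0) -> v = 0) -> row_free G.
Proof.
move=> betaE nondeg; rewrite -kermx_eq0; apply/rowV0P=> u /sub_kermxP uG.
rewrite -[u]r2vK [r2v u]nondeg ?linear0 // => w.
by rewrite betaE r2vK uG mul0mx mxE.
Qed.

Lemma gram_inj (V W : vectType K) (G H : 'M[K]_(dim V, dim W)) :
  (forall v w, (v2r v *m G *m (v2r w)^T) 0 0 = (v2r v *m H *m (v2r w)^T) 0 0) -> G = H.
Proof.
move=> eqGH; apply/matrixP=> i j.
have := eqGH (r2v (delta_mx 0 i)) (r2v (delta_mx 0 j)).
by rewrite !r2vK -!rowE trmx_delta -!colE !mxE.
Qed.

Lemma form_tr p q (u : 'rV[K]_p) (G : 'M_(p, q)) (v : 'rV_q) :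
  (v *m G^T *m u^T) 0 0 = (u *m G *m v^T) 0 0.
Proof.
by have -> : v *m G^T *m u^T = (u *m G *m v^T)^T; rewrite ?mxE // !trmx_mul trmxK mulmxA.
Qed.

Lemma v2r_lfun (U V : vectType K) (f : 'Hom(U, V)) u : v2r (f u) = v2r u *m f2mx f.
Proof. by rewrite unlock /= r2vK. Qed.

(** With [G] and [H] the Gram matrices of [beta] and [gamma], adjointness reads [f G = s H g^T].
    Non-degeneracy makes [G] and [H^T] row-free, so multiplying by them preserves ranks. *)
Lemma rank_adjoint (U V W Z : vectType K) (f : 'Hom(U, V)) (g : 'Hom(W, Z))
    (beta : V -> W -> K) (gamma : U -> Z -> K) (s : K) :
    bilinear_for *%R *%R beta -> bilinear_for *%R *%R gamma -> s != 0 ->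
    (forall v, (forall w, beta v w = 0) -> v = 0) ->
    (forall z, (forall u, gamma u z = 0) -> z = 0) ->
    (forall u w, beta (f u) w = s * gamma u (g w)) ->
  \dim (limg f) = \dim (limg g).
Proof.
move=> /exists_gram[G betaE] /exists_gram[H gammaE] nz_s ndl ndr adj.
have freeG := gram_row_free betaE ndl.
have freeH : row_free H^T.
  apply: (gram_row_free (beta := fun z u => gamma u z)) => // z u.
  by rewrite gammaE form_tr.
have eqGH : f2mx f *m G = s *: (H *m (f2mx g)^T).
  apply: gram_inj => u w; have := adj u w; rewrite betaE gammaE !v2r_lfun.
  by rewrite trmx_mul !mulmxA -scalemxAr -scalemxAl => ->; rewrite [RHS]mxE !mulmxA.
rewrite !rank_limg -(mxrankMfree _ freeG) eqGH mxrank_scale_nz //.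
by rewrite -mxrank_tr trmx_mul trmxK mxrankMfree.
Qed.

(** The Gram matrix of [beta (f u) u'] is the matrix of [f] times a row-free one: it is
    antisymmetric and has the rank of [f]. *)
Lemma antisym_pairing_rank_even (U V : vectType K) (f : 'Hom(U, V)) (beta : V -> U -> K) :
    2%:R != 0 :> K -> bilinear_for *%R *%R beta ->
    (forall v, (forall u, beta v u = 0) -> v = 0) ->
    (forall u u', beta (f u) u' = - beta (f u') u) ->
  ~~ odd (\dim (limg f)).
Proof.
move=> nz2 /exists_gram[G betaE] nd skew; have freeG := gram_row_free betaE nd.
rewrite rank_limg -(mxrankMfree _ freeG) antisym_rank_even //.
apply: gram_inj => u u'; have := skew u u'; rewrite !betaE !v2r_lfun.
by rewrite form_tr mulmxN mulNmx !mulmxA => e; rewrite [RHS]mxE e opprK.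
Qed.

End GramMatrices.

(** * Components of vectors of the direct sum *)

Section DirectSumInjections.

Variables (K : fieldType) (n : nat) (V : 'I_n -> vectType K).

Lemma dsumDE (u v : dsum V) i : (u + v) i = u i + v i.
Proof. exact: ffunE. Qed.

Lemma dsumZE (c : K) (u : dsum V) i : (c *: u) i = c *: u i.
Proof. exact: ffunE. Qed.

Lemma dsum0E i : (0 : dsum V) i = 0.
Proof. exact: ffunE. Qed.

Lemma dsum_sumE I (r : seq I) (P : pred I) (F : I -> dsum V) i :
  (\sum_(j <- r | P j) F j) i = \sum_(j <- r | P j) F j i.
Proof.
by elim/big_rec2: _ => [|j y z _ <-]; rewrite ?dsum0E ?dsumDE.
Qed.

Lemma dsum_inj_in i (x : V i) : dsum_inj x i = x.
Proof. by rewrite ffunE dfwith_in. Qed.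

Lemma dsum_inj_out i j (x : V i) : i != j -> dsum_inj x j = 0.
Proof. by move=> ne_ij; rewrite ffunE dfwith_out. Qed.

Lemma dsum_inj_linear i : linear (@dsum_inj K n V i).
Proof.
move=> c x y; apply/ffunP=> j; rewrite dsumDE dsumZE.
have [<-|ne_ij] := eqVneq i j; first by rewrite !dsum_inj_in.
by rewrite !dsum_inj_out // scaler0 addr0.
Qed.

Lemma dsum_inj_sum (v : dsum V) : v = \sum_i dsum_inj (v i).
Proof.
apply/ffunP=> i; rewrite dsum_sumE (bigD1 i) //= dsum_inj_in big1 ?addr0 // => j ne_ji.
exact: dsum_inj_out.
Qed.

End DirectSumInjections.

(** * Rank conditions forced by an eps-structure *)

Section FromStructure.

Variables (K : fieldType) (n : nat) (eps : K) (M : quiver_rep K n).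
Variable B : {biscalar dsum M}.
Hypothesis formB : sigma_compatible_form eps B.
Hypothesis adjB : forall (i j : 'I_n) (e : j = i.+1 :> nat) (v : M i) (w : M (rev_ord j)),
  B (dsum_inj (rmap M e v)) (dsum_inj w)
  + B (dsum_inj v) (dsum_inj (rmap M (rev_ord_arrow e) w)) = 0.

Let beta i j (v : M i) (w : M j) : K := B (dsum_inj v) (dsum_inj w).

Lemma pairing_bilinear i j : bilinear_for *%R *%R (@beta i j).
Proof.
by split=> [w|v] c x y; rewrite /beta dsum_inj_linear; [rewrite linearPl | rewrite linearPr].
Qed.

(** By compatibility [dsum_inj v] is orthogonal to every summand except the one at [rev_ord i], so
    non-degeneracy of [B] restricts to this block. *)
Lemma pairing_nondegenerate i j (v : M i) : j = rev_ord i ->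
  (forall w : M j, beta v w = 0) -> v = 0.
Proof.
move=> def_j v0; rewrite -(dsum_inj_in v).
suff -> : dsum_inj v = 0 by rewrite dsum0E.
apply: (scf_nondegenerate formB) => w; rewrite (dsum_inj_sum w) linear_sumr big1 // => k _.
have [eq_kj|ne_kj] := eqVneq k j; first by subst k; apply: v0.
by apply: (scf_compat formB); apply/eqP; rewrite -def_j.
Qed.

(** Iterates [adjB] along the [j - i] arrows, with one sign for each. The vertices [k] and [l] are
    variables because [rev_ord (rev_ord i)] is not convertible to [i]. *)
Lemma pairing_adjoint (i j k l : 'I_n) (v : M i) (w : M k) : (i <= j)%N ->
    k = rev_ord j -> l = rev_ord i ->
  beta (rcomp0 M i j v) w = (-1) ^+ (j - i) * beta v (rcomp0 M k l w).
Proof.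
move=> le_ij def_k def_l; subst k l.
case: j le_ij w => j; elim: j => [|j IHj] lt_j le_ij w.
  have def_j : Ordinal lt_j = i by apply/val_inj/esym/eqP; rewrite -leqn0.
  by move: w; rewrite def_j => w; rewrite !rcomp0_id !id_lfunE subnn expr0 mul1r.
case: (ltngtP i j.+1) (le_ij) => // [lt_ij|eq_ij] _; last first.
  have def_j : Ordinal lt_j = i by apply: val_inj.
  by move: w; rewrite def_j => w; rewrite !rcomp0_id !id_lfunE subnn expr0 mul1r.
have lt_j' : (j < n)%N by apply: ltnW.
have e : Ordinal lt_j = (Ordinal lt_j').+1 :> nat by [].
rewrite -(@rmap_rcomp0 _ _ _ _ (Ordinal lt_j') _ e) //.
have := adjB e (rcomp0 M i (Ordinal lt_j') v) w => /eqP; rewrite addr_eq0 => /eqP.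
rewrite -!/(beta _ _) => ->.
rewrite IHj // rcomp0_rmap; last exact: rev_ord_le.
by rewrite /= subSn // exprS mulN1r mulNr.
Qed.

Lemma rank_sym (i j : 'I_n) (le_ij : (i <= j)%N) :
  rank_seq M le_ij = rank_seq M (rev_ord_le le_ij).
Proof.
rewrite /rank_seq -!rcomp0E.
apply: (rank_adjoint (s := (-1) ^+ (j - i)) (pairing_bilinear _ _) (pairing_bilinear _ _)).
- by rewrite signr_eq0.
- by move=> v; apply: pairing_nondegenerate.
- move=> z z0; apply: (@pairing_nondegenerate _ i) => [|u]; first by rewrite rev_ordK.
  by rewrite /beta (scf_sym formB) -/(beta _ _) z0 mulr0.
by move=> u w; apply: pairing_adjoint.
Qed.

(** For [u], [u'] at vertex [i], exchanging them in the form [B (f u) u'] costs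
    [(-1) ^+ (n - 1 - 2i)] by adjointness and [eps] by symmetry; the sign condition makes the
    product [-1]. *)
Lemma rank_even (i : 'I_n) (le_is : (i <= rev_ord i)%N) :
  2%:R != 0 :> K -> eps * (-1) ^+ n = 1 -> ~~ odd (rank_seq M le_is).
Proof.
move=> nz2 sgn; rewrite /rank_seq -rcomp0E.
apply: (antisym_pairing_rank_even nz2 (pairing_bilinear _ _)) => [v|u u'].
  by apply: pairing_nondegenerate; rewrite rev_ordK.
rewrite (@pairing_adjoint _ _ i (rev_ord i)) ?rev_ordK // /beta (scf_sym formB) mulrA.
rewrite -[RHS]mulN1r; congr (_ * _); rewrite -signr_odd.
have -> : odd (rev_ord i - i) = ~~ odd n by move: le_is (ltn_ord i) => /=; lia.
by rewrite signrN signr_odd mulNr mulrC sgn.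
Qed.

End FromStructure.

(** * The form defined by a reversing involution of the summands *)

Section ToStructure.

Variables (K : fieldType) (n : nat) (eps : K) (M : quiver_rep K n) (T : finType).
Variables (a b : T -> 'I_n) (x : T -> forall i, M i) (xi : T -> forall i, 'Hom(M i, K^o)).
Hypothesis decM : interval_decomposition (fun=> fullv) a b x xi.
Variables (tau : T -> T) (sg : T -> bool) (alt : bool).
Hypotheses (tauK : involutive tau) (a_tau : forall t, a (tau t) = rev_ord (b t)).
Hypotheses (b_tau : forall t, b (tau t) = rev_ord (a t)).
Hypothesis sg_tau : forall t, sg (tau t) = alt (+) sg t.
Hypothesis eps_alt : eps = (-1) ^+ (alt + n.+1).

(** Alternation in [i] gives the sign in the adjointness relation; [sg t] tunes the symmetry to
    [eps]. *)
Definition idec_form (v w : dsum M) : K :=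
  \sum_t \sum_(i < n) (-1) ^+ (sg t + i) * (xi t i (v i) * xi (tau t) (rev_ord i) (w (rev_ord i))).

Lemma idec_form_bilinear : bilinear_for *%R *%R idec_form.
Proof.
have distl (s c p q z : K) : s * ((c * p + q) * z) = c * (s * (p * z)) + s * (q * z) by ring.
have distr (s c p q z : K) : s * (z * (c * p + q)) = c * (s * (z * p)) + s * (z * q) by ring.
split=> [w|v] c x' y; rewrite /idec_form /= mulr_sumr -big_split /=; apply: eq_bigr => t _;
  rewrite mulr_sumr -big_split /=; apply: eq_bigr => i _;
  rewrite dsumDE dsumZE linearP; [exact: distl | exact: distr].
Qed.

Lemma idec_form_inj (i j : 'I_n) (v : M i) (w : M j) : j = rev_ord i ->
  idec_form (dsum_inj v) (dsum_inj w)
    = \sum_t (-1) ^+ (sg t + i) * (xi t i v * xi (tau t) j w).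
Proof.
move=> def_j; subst j; apply: eq_bigr => t _; rewrite (bigD1 i) //= !dsum_inj_in.
rewrite big1 ?addr0 // => k ne_ki.
by rewrite dsum_inj_out 1?eq_sym // linear0 mul0r mulr0.
Qed.

Lemma idec_form_out (i j : 'I_n) (v : M i) (w : M j) : j <> rev_ord i ->
  idec_form (dsum_inj v) (dsum_inj w) = 0.
Proof.
move=> ne_j; rewrite /idec_form big1 // => t _; rewrite big1 // => k _.
have [eq_ik|ne_ik] := eqVneq i k; last by rewrite dsum_inj_out // linear0 mul0r mulr0.
subst k; rewrite (dsum_inj_out w) ?linear0 ?mulr0 //.
by apply/eqP.
Qed.

(** Replacing [t] by [tau t] and [i] by [rev_ord i] changes the exponent [sg t + i] by [alt + n.+1]
    modulo 2, which is the exponent of [eps_alt]. *)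
Lemma idec_form_sym v w : idec_form v w = eps * idec_form w v.
Proof.
rewrite /idec_form mulr_sumr (reindex_inj (inv_inj tauK)) /=; apply: eq_bigr => t _.
rewrite mulr_sumr (reindex_inj rev_ord_inj) /=; apply: eq_bigr => i _.
rewrite tauK rev_ordK [RHS]mulrA [xi t i _ * _]mulrC; congr (_ * _).
rewrite eps_alt sg_tau -exprD -signr_odd -[RHS]signr_odd; congr (_ ^+ _).
by case: alt; case: (sg t); move: (ltn_ord i) => /=; lia.
Qed.

(** Testing against the basis vector [x (tau t) (rev_ord i)] isolates the coordinate [xi t i (v i)]
    up to sign. *)
Lemma idec_form_nondegenerate v : (forall w, idec_form v w = 0) -> v = 0.
Proof.
move=> v0; apply/ffunP=> i; rewrite dsum0E.
rewrite (idec_span decM (memvf (v i) : v i \in (fun=> fullv) i)) big1 // => t _.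
have [in_t|out_t] := boolP (a t <= i <= b t)%N; last first.
  by rewrite (idec_out decM) // scaler0.
have := v0 (dsum_inj (x (tau t) (rev_ord i))).
rewrite /idec_form (bigD1 t) //= (bigD1 i) //= !dsum_inj_in (idec_dual decM) eqxx.
rewrite big1 => [|k ne_ki]; last first.
  rewrite (dsum_inj_out (x _ _)) ?linear0 ?mulr0 //.
  by rewrite (inj_eq rev_ord_inj) eq_sym.
rewrite big1 => [|s ne_st]; last first.
  rewrite big1 // => k _.
  have [->|ne_ki] := eqVneq k i; last first.
    rewrite (dsum_inj_out (x _ _)) ?linear0 ?mulr0 //.
    by rewrite (inj_eq rev_ord_inj) eq_sym.
  by rewrite dsum_inj_in (idec_dual decM) (inj_eq (inv_inj tauK)) eq_sym (negPf ne_st) !mulr0.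
have -> : (a (tau t) <= rev_ord i <= b (tau t))%N.
  by rewrite a_tau b_tau; case/andP: in_t => *; rewrite !rev_ord_le.
rewrite mulr1 !addr0 => /eqP; rewrite mulf_eq0 signr_eq0 /= => /eqP->.
exact: scale0r.
Qed.

(** As [tau] reverses intervals, the arrow from [i] to [j] lies in the interval of [t] exactly when
    the opposite arrow lies in that of [tau t]. Both terms thus survive for the same [t], with
    opposite signs at [i] and [i.+1]. *)
Lemma idec_form_adjoint (i j : 'I_n) (e : j = i.+1 :> nat) (v : M i) (w : M (rev_ord j)) :
  idec_form (dsum_inj (rmap M e v)) (dsum_inj w)
    + idec_form (dsum_inj v) (dsum_inj (rmap M (rev_ord_arrow e) w)) = 0.
Proof.
rewrite !idec_form_inj // -big_split big1 // => t _ /=.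
rewrite !(idec_coord_rmap decM) a_tau b_tau.
have -> : (rev_ord (b t) <= rev_ord j)%N && (rev_ord i <= rev_ord (a t))%N
    = (a t <= i)%N && (j <= b t)%N.
  by move: (ltn_ord (b t)) (ltn_ord i) (ltn_ord j) (ltn_ord (a t)) => /=; lia.
by rewrite e addnS exprS; ring.
Qed.

Lemma idec_admits_eps_structure : admits_eps_structure eps M.
Proof.
pose BB := bilinear_isBilinear.Build K _ _ _ _ _ _ idec_form_bilinear.
pose B : {biscalar dsum M} := HB.pack idec_form BB.
exists B; split; last exact: idec_form_adjoint.
split; [exact: idec_form_nondegenerate | exact: idec_form_sym | exact: idec_form_out].
Qed.

End ToStructure.

Theorem theorem2p9 (R : realType) (n : nat) (hn : (2 <= n)%N)
    (eps : R[i]) (heps : eps = 1 \/ eps = -1) (M : quiver_rep R[i] n) :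
  admits_eps_structure eps M <->
  (forall (i j : 'I_n) (le_ij : (i <= j)%N),
     rank_seq M le_ij = rank_seq M (rev_ord_le le_ij)) /\
  ((odd n /\ eps = -1) \/ (~~ odd n /\ eps = 1) ->
   forall (i : 'I_n) (le_is : (i <= rev_ord i)%N), ~~ odd (rank_seq M le_is)).
Proof.
have nz2 : 2%:R != 0 :> R[i] by rewrite Num.Theory.pnatr_eq0.
have ne1N1 : (1 == -1 :> R[i]) = false by apply/negbTE; rewrite -addr_eq0.
split=> [[B [formB adjB]] | [sym_r even_r]].
  split=> [i j le_ij | sgn i le_is]; first exact: (rank_sym formB adjB).
  apply: (rank_even formB adjB) => //; rewrite -signr_odd.
  case: sgn => [] [odd_n ->]; first by rewrite odd_n mulrNN mulr1.
  by rewrite (negPf odd_n) mulr1.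
have [T [a [b [x [xi decM]]]]] :=
  exists_interval_decomposition (M := M) (U := fun=> fullv) (fun _ _ _ _ _ => memvf _).
have rankE := rank_idec decM.
(* Given [heps], the boolean passed as [alt] holds exactly in the two cases of the parity
   condition. *)
have [||tau [sg [tauK a_tau b_tau sg_tau]]] :=
  @interval_involution n T a b (idec_le decM) _ (odd n == (eps == -1)).
- by move=> i j le_ij; rewrite -(rankE i j le_ij) sym_r rankE.
- move=> alt i le_is; rewrite -(rankE i _ le_is) even_r //.
  case: heps alt => ->; rewrite ?eqxx ?ne1N1.
    by move/eqP->; right.
  by move/eqP->; left.
apply: (idec_admits_eps_structure decM tauK a_tau b_tau sg_tau).
rewrite -signr_odd oddD /=; case: heps => ->; rewrite ?eqxx ?ne1N1;
  by case: (odd n).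
Qed.
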